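(* The category $\mathsf{Dir}$ of Dirichlet functors is an elementary topos.
   Context: $\mathsf{Fin}$ is the category of finite sets and functions. A Dirichlet functor (Dirichlet polynomial) is a functor $D\colon\mathsf{Fin}^{\mathrm{op}}\to\mathsf{Fin}$ that can be expressed as a (finite, possibly empty) sum of representable presheaves, $D\cong\sum_{i=1}^{D(0)}\mathsf{Fin}(-,d_i)$ with each $d_i$ a finite set. $\mathsf{Dir}$ is the (skeleton of the) full subcategory of the functor category $\mathsf{Fin}^{(\mathsf{Fin}^{\mathrm{op}})}$ spanned by the Dirichlet functors, so its morphisms are all natural transformations between them. *)

(* Defs.v *)
From mathcomp Require Import all_boot.
From mathcomp Require Import boolp.

Set Implicit Arguments.
Unset Strict Implicit.
Unset Printing Implicit Defensive.

Declare Scope cat_scope.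
Delimit Scope cat_scope with cat.

Record Category := {
  Obj :> Type;
  Hom : Obj -> Obj -> Type;
  idm : forall X : Obj, Hom X X;
  comp : forall X Y Z : Obj, Hom Y Z -> Hom X Y -> Hom X Z;
  comp_idl : forall (X Y : Obj) (f : Hom X Y), comp (idm Y) f = f;
  comp_idr : forall (X Y : Obj) (f : Hom X Y), comp f (idm X) = f;
  comp_assoc : forall (X Y Z W : Obj) (h : Hom Z W) (g : Hom Y Z) (f : Hom X Y),
    comp h (comp g f) = comp (comp h g) f }.

Arguments Hom {c} X Y.
Arguments idm {c} X.
Arguments comp {c X Y Z} g f.
Notation "g ∘ f" := (comp g f) (at level 40, left associativity) : cat_scope.
Local Open Scope cat_scope.

Definition opposite (C : Category) : Category := {|
  Obj := Obj C;
  Hom := fun X Y => @Hom C Y X;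
  idm := fun X => @idm C X;
  comp := fun X Y Z g f => @comp C Z Y X f g;
  comp_idl := fun X Y f => @comp_idr C Y X f;
  comp_idr := fun X Y f => @comp_idl C Y X f;
  comp_assoc := fun X Y Z W h g f => esym (@comp_assoc C W Z Y X f g h) |}.

Definition full_subcategory (C : Category) (P : C -> Prop) : Category := {|
  Obj := {X : C | P X};
  Hom := fun X Y => @Hom C (sval X) (sval Y);
  idm := fun X => @idm C (sval X);
  comp := fun X Y Z => @comp C (sval X) (sval Y) (sval Z);
  comp_idl := fun X Y => @comp_idl C (sval X) (sval Y);
  comp_idr := fun X Y => @comp_idr C (sval X) (sval Y);
  comp_assoc := fun X Y Z W =>
    @comp_assoc C (sval X) (sval Y) (sval Z) (sval W) |}.

Definition isomorphic (C : Category) (X Y : C) : Prop :=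
  exists (f : Hom X Y) (g : Hom Y X), g ∘ f = idm X /\ f ∘ g = idm Y.

Definition is_skeleton (C : Category) (S : C -> Prop) : Prop :=
  (forall X : C, exists2 Y : C, S Y & isomorphic X Y) /\
  (forall X Y : C, S X -> S Y -> isomorphic X Y -> X = Y).

Record Functor (C D : Category) := {
  fobj :> C -> D;
  fmap : forall X Y : C, Hom X Y -> Hom (fobj X) (fobj Y);
  fmap_id : forall X : C, fmap (idm X) = idm (fobj X);
  fmap_comp : forall (X Y Z : C) (g : Hom Y Z) (f : Hom X Y),
    fmap (g ∘ f) = fmap g ∘ fmap f }.

Arguments fmap {C D} F {X Y} f : rename.

Record NatTrans (C D : Category) (F G : Functor C D) := {
  component :> forall X : C, Hom (F X) (G X);
  naturality : forall (X Y : C) (f : Hom X Y),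
    component Y ∘ fmap F f = fmap G f ∘ component X }.

Lemma NatTrans_ext (C D : Category) (F G : Functor C D) (s t : NatTrans F G) :
  (forall X : C, s X = t X) -> s = t.
Proof.
case: s t => [s sn] [t tn] /= st.
have {}st : s = t by apply: functional_extensionality_dep.
by case: t / st tn => tn; congr Build_NatTrans; apply: Prop_irrelevance.
Qed.

Section FunctorCategory.
Variables C D : Category.

Program Definition nat_id (F : Functor C D) : NatTrans F F :=
  {| component := fun X => idm (F X) |}.
Next Obligation. by rewrite comp_idl comp_idr. Qed.

Program Definition nat_comp (F G H : Functor C D)
    (t : NatTrans G H) (s : NatTrans F G) : NatTrans F H :=
  {| component := fun X => t X ∘ s X |}.
Next Obligation.
by rewrite -comp_assoc naturality comp_assoc naturality comp_assoc.
Qed.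

Program Definition functor_category : Category := {|
  Obj := Functor C D;
  Hom := @NatTrans C D;
  idm := nat_id;
  comp := nat_comp |}.
Next Obligation. by apply: NatTrans_ext => Z /=; rewrite comp_idl. Qed.
Next Obligation. by apply: NatTrans_ext => Z /=; rewrite comp_idr. Qed.
Next Obligation. by apply: NatTrans_ext => V /=; rewrite comp_assoc. Qed.

End FunctorCategory.

Section Topos.
Variable C : Category.

Definition is_mono (X Y : C) (m : Hom X Y) : Prop :=
  forall (Z : C) (f g : Hom Z X), m ∘ f = m ∘ g -> f = g.

Definition is_terminal (T : C) : Prop :=
  forall X : C, exists! f : Hom X T, True.

Definition is_product (A B P : C) (p1 : Hom P A) (p2 : Hom P B) : Prop :=
  forall (X : C) (f : Hom X A) (g : Hom X B),
    exists! h : Hom X P, p1 ∘ h = f /\ p2 ∘ h = g.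

Definition is_pullback (A B Z P : C) (p1 : Hom P A) (p2 : Hom P B)
    (f : Hom A Z) (g : Hom B Z) : Prop :=
  f ∘ p1 = g ∘ p2 /\
  forall (X : C) (a : Hom X A) (b : Hom X B), f ∘ a = g ∘ b ->
    exists! h : Hom X P, p1 ∘ h = a /\ p2 ∘ h = b.

Record Cone (J : Category) (F : Functor J C) := {
  apex : C;
  leg : forall j : J, Hom apex (F j);
  leg_natural : forall (i j : J) (u : Hom i j), fmap F u ∘ leg i = leg j }.

Definition is_limit (J : Category) (F : Functor J C) (c : Cone F) : Prop :=
  forall d : Cone F,
    exists! h : Hom (apex d) (apex c), forall j : J, leg c j ∘ h = leg d j.

(* Not phrased with a [finType] structure on [T]: the objects of an arbitrary
   [Category] live in a larger universe than the carriers of [finType]. *)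
Definition is_finite (T : Type) : Prop :=
  exists (n : nat) (e : 'I_n -> T), forall x : T, exists i : 'I_n, e i = x.

Definition is_finite_category (J : Category) : Prop :=
  is_finite J /\ forall i j : J, is_finite (Hom i j).

Definition has_finite_limits : Prop :=
  forall J : Category, is_finite_category J ->
  forall F : Functor J C, exists c : Cone F, is_limit c.

(* [ev : EA -> B] exhibits [E] as [B ^ A], where [EA] is the product [E x A];
   the morphism [h] below is [g x id_A]. *)
Definition is_exponential (A B E EA : C)
    (p1 : Hom EA E) (p2 : Hom EA A) (ev : Hom EA B) : Prop :=
  is_product p1 p2 /\
  forall (X XA : C) (q1 : Hom XA X) (q2 : Hom XA A), is_product q1 q2 ->
  forall f : Hom XA B,
    exists! g : Hom X E,
      exists h : Hom XA EA, [/\ p1 ∘ h = g ∘ q1, p2 ∘ h = q2 & ev ∘ h = f].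

Definition is_cartesian_closed : Prop :=
  [/\ exists T : C, is_terminal T,
      forall A B : C, exists (P : C) (p1 : Hom P A) (p2 : Hom P B),
        is_product p1 p2
    & forall A B : C, exists (E EA : C)
        (p1 : Hom EA E) (p2 : Hom EA A) (ev : Hom EA B),
        is_exponential p1 p2 ev].

Definition is_subobject_classifier (T Omega : C) (true_ : Hom T Omega) : Prop :=
  is_terminal T /\
  forall (U X : C) (m : Hom U X) (u : Hom U T), is_mono m ->
    exists! chi : Hom X Omega, is_pullback m u chi true_.

Definition has_subobject_classifier : Prop :=
  exists (T Omega : C) (true_ : Hom T Omega), is_subobject_classifier true_.

Definition is_elementary_topos : Prop :=
  [/\ has_finite_limits, is_cartesian_closed & has_subobject_classifier].

End Topos.

Definition fin_id (X : finType) : {ffun X -> X} := [ffun x => x].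

Definition fin_comp (X Y Z : finType) (g : {ffun Y -> Z}) (f : {ffun X -> Y}) :
  {ffun X -> Z} := [ffun x => g (f x)].

Program Definition Fin : Category := {|
  Obj := finType;
  Hom := fun X Y : finType => {ffun X -> Y};
  idm := fin_id;
  comp := fin_comp |}.
Next Obligation. by apply/ffunP => x; rewrite !ffunE. Qed.
Next Obligation. by apply/ffunP => x; rewrite !ffunE. Qed.
Next Obligation. by apply/ffunP => x; rewrite !ffunE. Qed.

Definition Presheaf : Category := functor_category (opposite Fin) Fin.

Program Definition representable (d : finType) : Presheaf := {|
  fobj := fun X : opposite Fin => ({ffun X -> d} : finType);
  fmap := fun (X Y : opposite Fin) (f : Hom X Y) =>
    [ffun s : {ffun X -> d} => @comp Fin Y X d s f] |}.
Next Obligation. by apply/ffunP => s; rewrite !ffunE; exact: (@comp_idr Fin). Qed.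
Next Obligation. by apply/ffunP => s; rewrite !ffunE; exact: (@comp_assoc Fin). Qed.

Program Definition presheaf_sum (I : finType) (F : I -> Presheaf) : Presheaf := {|
  fobj := fun X : opposite Fin => ({i : I & F i X} : finType);
  fmap := fun (X Y : opposite Fin) (f : Hom X Y) =>
    [ffun s : {i : I & F i X} =>
       existT (fun i => F i Y) (tag s) (fmap (F (tag s)) f (tagged s))] |}.
Next Obligation.
by apply/ffunP => -[i s]; rewrite !ffunE /= fmap_id /= ffunE.
Qed.
Next Obligation.
by apply/ffunP => -[i s]; rewrite !ffunE /= fmap_comp /= ffunE.
Qed.

(* [D void] is D(0); it has one element per summand, as [Fin(0, d i)] is a
   singleton. *)
Definition is_dirichlet (D : Presheaf) : Prop :=
  exists d : 'I_#|D void| -> finType,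
    isomorphic D (presheaf_sum (fun i => representable (d i))).

Definition Dir : Category := full_subcategory is_dirichlet.

(* Main.v *)
(** A Dirichlet functor [D] is determined by the map [D(1) -> D(0)] induced by
    [0 -> 1]: an element of [D(X)] is an element of [D(0)] together with an
    [X]-indexed family in the fibre over it. Hence [D |-> (D(1) -> D(0))] is an
    equivalence from [Dir] to the category of maps of finite sets, that is, of
    finite-set-valued presheaves on the arrow category [0 -> 1]. The latter is a
    topos by the usual pointwise formulas, and being an elementary topos is
    invariant under equivalence, which also covers the skeletons of [Dir]. *)
From mathcomp Require Import all_boot.
From mathcomp Require Import boolp.
Require Import Defs.

Set Implicit Arguments.
Unset Strict Implicit.
Unset Printing Implicit Defensive.

Local Open Scope cat_scope.

(** * Invariance under equivalence *)

Definition inverse_pair (C : Category) (X Y : C) (f : Hom X Y) (g : Hom Y X) :=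
  g ∘ f = idm X /\ f ∘ g = idm Y.

Lemma compK (C : Category) (X Y Z : C) (f : Hom X Y) (g : Hom Y X)
    (h : Hom Z X) : g ∘ f = idm X -> g ∘ (f ∘ h) = h.
Proof. by move=> gf; rewrite comp_assoc gf comp_idl. Qed.

Lemma split_mono (C : Category) (X Y : C) (f : Hom X Y) (g : Hom Y X) :
  g ∘ f = idm X -> is_mono f.
Proof. by move=> gf Z a b e; rewrite -(compK a gf) e compK. Qed.

(** * Replacing the objects of a universal construction by isomorphic ones *)

Section Replacement.
Variable C : Category.

Lemma terminal_iso (T T' : C) (t : Hom T' T) (t' : Hom T T') :
  inverse_pair t t' -> is_terminal T -> is_terminal T'.
Proof.
move=> [t't _] tT X; have [f [_ f_uniq]] := tT X.
exists (t' ∘ f); split=> // g _.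
by rewrite (f_uniq (t ∘ g)) // compK.
Qed.

(** The legs are exposed separately, not packed in a [Cone], because [transfer_limits] lifts them
    one by one along a full functor before building a cone from them. *)
Lemma limit_iso (J : Category) (F : Functor J C) (c : Cone F) (L : C)
    (l : Hom L (apex c)) (l' : Hom (apex c) L) :
  inverse_pair l l' -> is_limit c ->
  exists2 legs : forall j : J, Hom L (F j),
    forall (i j : J) (u : Hom i j), fmap F u ∘ legs i = legs j &
    forall d : Cone F,
      exists! h : Hom (apex d) L, forall j : J, legs j ∘ h = leg d j.
Proof.
move=> [l'l ll'] lim_c; exists (fun j => leg c j ∘ l) => [i j u|d].
  by rewrite comp_assoc leg_natural.
have [h [hE h_uniq]] := lim_c d.
exists (l' ∘ h); split=> [j|g gE]; first by rewrite -comp_assoc compK.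
by rewrite (h_uniq (l ∘ g)) ?compK // => j; rewrite comp_assoc.
Qed.

Lemma product_iso (A A' B P P' : C) (p1 : Hom P A) (p2 : Hom P B)
    (a : Hom A' A) (a' : Hom A A') (p : Hom P' P) (p' : Hom P P') :
  inverse_pair a a' -> inverse_pair p p' -> is_product p1 p2 ->
  is_product (a' ∘ p1 ∘ p) (p2 ∘ p).
Proof.
move=> [a'a aa'] [p'p pp'] prodP X f g.
have [h [[h1 h2] h_uniq]] := prodP X (a ∘ f) g.
exists (p' ∘ h); split.
  by rewrite -!comp_assoc !(compK _ pp') h1 h2 (compK _ a'a).
move=> k [k1 k2]; rewrite (h_uniq (p ∘ k)) ?compK //; split; last first.
  by rewrite comp_assoc.
by rewrite -k1 -!comp_assoc compK.
Qed.

Lemma inverse_pair_id (X : C) : inverse_pair (idm X) (idm X).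
Proof. by split; rewrite comp_idl. Qed.

(** Only [E] and [EA] move: in the transfer below [A] and [B] already lie in the image of the
    functor, while the exponential must be brought into it. *)
Lemma exponential_iso (A B E E' EA EA' : C)
    (p1 : Hom EA E) (p2 : Hom EA A) (ev : Hom EA B)
    (e : Hom E' E) (e' : Hom E E') (a : Hom EA' EA) (a' : Hom EA EA') :
  inverse_pair e e' -> inverse_pair a a' -> is_exponential p1 p2 ev ->
  is_exponential (e' ∘ p1 ∘ a) (p2 ∘ a) (ev ∘ a).
Proof.
move=> ee aa [prodE expE]; split; first exact: product_iso ee aa prodE.
move: ee aa => [e'e ee'] [a'a aa'] X XA q1 q2 prodX f.
have [g [[h [h1 h2 h3]] g_uniq]] := expE X XA q1 q2 prodX f.
exists (e' ∘ g); split.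
  by exists (a' ∘ h); split; rewrite -!comp_assoc (compK _ aa') ?h1.
move=> k [l [l1 l2 l3]]; rewrite (g_uniq (e ∘ k)) ?compK //.
exists (a ∘ l); split; rewrite ?comp_assoc //.
by rewrite -(comp_assoc e) -l1 -!comp_assoc compK.
Qed.

(** Both directions serve in [classifier_iso]: one for the existence of the characteristic map, the
    other for its uniqueness. *)
Lemma pullback_iso (U X T T' O O' : C) (m : Hom U X) (u : Hom U T')
    (chi : Hom X O') (tr : Hom T O)
    (t : Hom T' T) (t' : Hom T T') (w : Hom O' O) (w' : Hom O O') :
  inverse_pair t t' -> inverse_pair w w' ->
  is_pullback m u chi (w' ∘ tr ∘ t) <-> is_pullback m (t ∘ u) (w ∘ chi) tr.
Proof.
move=> [t't tt'] [w'w ww']; split=> -[sq pb]; split.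
- by rewrite -comp_assoc sq -!comp_assoc compK.
- move=> Z a b ab; have [|h [[h1 h2] h_uniq]] := pb Z a (t' ∘ b).
    by rewrite -!comp_assoc (compK _ tt') -ab -comp_assoc compK.
  exists h; split; first by rewrite -comp_assoc h2 compK.
  by move=> k [k1 k2]; apply: h_uniq; split=> //; rewrite -k2 -comp_assoc compK.
- by rewrite -!comp_assoc -sq -comp_assoc compK.
- move=> Z a b ab; have [|h [[h1 h2] h_uniq]] := pb Z a (t ∘ b).
    by rewrite -comp_assoc ab -!comp_assoc compK.
  exists h; split.
    by split=> //; apply: (split_mono t't); rewrite comp_assoc.
  by move=> k [k1 k2]; apply: h_uniq; split=> //; rewrite -k2 comp_assoc.
Qed.

Lemma classifier_iso (T T' O O' : C) (tr : Hom T O)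
    (t : Hom T' T) (t' : Hom T T') (w : Hom O' O) (w' : Hom O O') :
  inverse_pair t t' -> inverse_pair w w' ->
  is_subobject_classifier tr -> is_subobject_classifier (w' ∘ tr ∘ t).
Proof.
move=> tt ww [termT clT]; split; first exact: (terminal_iso tt).
move=> U X m u mono_m.
have [chi [pb chi_uniq]] := clT U X m (t ∘ u) mono_m.
have [w'w ww'] := ww.
exists (w' ∘ chi); split; first by apply/(pullback_iso _ _ _ _ tt ww); rewrite compK.
move=> chi2 /(pullback_iso _ _ _ _ tt ww) pb2.
by rewrite (chi_uniq _ pb2) compK.
Qed.

(** Any two products of [X] and [A] are related by the isomorphisms [i] and [j], which carry the
    universal property from one to the other. So [is_exponential], which quantifies over all
    products, can be checked on a convenient one for each [X]. *)
Lemma exponential_of_one_product (A B E EA : C)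
    (p1 : Hom EA E) (p2 : Hom EA A) (ev : Hom EA B) :
  is_product p1 p2 ->
  (forall X : C, exists (XA : C) (q1 : Hom XA X) (q2 : Hom XA A),
     is_product q1 q2 /\
     forall f : Hom XA B, exists! g : Hom X E, exists h : Hom XA EA,
       [/\ p1 ∘ h = g ∘ q1, p2 ∘ h = q2 & ev ∘ h = f]) ->
  is_exponential p1 p2 ev.
Proof.
move=> prodE expE; split=> // X XA q1 q2 prodX f.
have [P [r1 [r2 [prodP univ]]]] := expE X.
have [i [[i1 i2] _]] := prodX P r1 r2.
have [j [[j1 j2] _]] := prodP XA q1 q2.
have ji : j ∘ i = idm P.
  have [k [_ k_uniq]] := prodP P r1 r2; rewrite -(k_uniq (j ∘ i)).
    by apply: k_uniq; rewrite !comp_idr.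
  by rewrite !comp_assoc j1 j2.
have ij : i ∘ j = idm XA.
  have [k [_ k_uniq]] := prodX XA q1 q2; rewrite -(k_uniq (i ∘ j)).
    by apply: k_uniq; rewrite !comp_idr.
  by rewrite !comp_assoc i1 i2.
have [g [[h [h1 h2 h3]] g_uniq]] := univ (f ∘ i).
exists g; split.
  exists (h ∘ j); split; rewrite comp_assoc ?h1 ?h2 ?h3 -?comp_assoc ?j1 ?j2 //.
  by rewrite ij comp_idr.
move=> g' [h' [h1' h2' h3']]; apply: g_uniq.
by exists (h' ∘ i); split; rewrite comp_assoc ?h1' ?h2' ?h3' // -?comp_assoc ?i1 ?i2.
Qed.

End Replacement.

Definition functor_comp (B C D : Category) (F : Functor C D) (G : Functor B C) :
    Functor B D := {|
  fobj := fun X => F (G X);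
  fmap := fun X Y u => fmap F (fmap G u);
  fmap_id := fun X => etrans (congr1 (fmap F) (fmap_id G X)) (fmap_id F (G X));
  fmap_comp := fun X Y Z v u =>
    etrans (congr1 (fmap F) (fmap_comp G v u)) (fmap_comp F _ _) |}.

(** * Transfer of the topos axioms along an equivalence of categories *)

Section Transfer.
Variables (C D : Category) (F : Functor C D).
Hypothesis F_full : forall (X Y : C) (h : Hom (F X) (F Y)), exists f, fmap F f = h.
Hypothesis F_faithful : forall (X Y : C) (f g : Hom X Y), fmap F f = fmap F g -> f = g.
Hypothesis F_surj : forall Y : D, exists X : C, isomorphic (F X) Y.

(** Fullness and faithfulness make [fmap F] a bijection on morphisms. All universal properties below
    are pulled back to [C] through this lemma. *)
Lemma unique_lift (X Y : C) (Q : Hom (F X) (F Y) -> Prop) (R : Hom X Y -> Prop) :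
  (forall f, R f <-> Q (fmap F f)) ->
  (exists! h, Q h) -> exists! f, R f.
Proof.
move=> RQ [h]; have [f <-] := F_full h; move=> [Qf f_uniq].
by exists f; split=> [|g /RQ /f_uniq /F_faithful //]; apply/RQ.
Qed.

Lemma reflect_terminal (T : C) : is_terminal (F T) -> is_terminal T.
Proof. by move=> tT X; apply: unique_lift (tT (F X)). Qed.

Lemma reflect_product (A B P : C) (p1 : Hom P A) (p2 : Hom P B) :
  is_product (fmap F p1) (fmap F p2) -> is_product p1 p2.
Proof.
move=> prodP X f g; apply: unique_lift (prodP (F X) (fmap F f) (fmap F g)) => h.
by rewrite -!fmap_comp; split=> -[] => [-> ->|/F_faithful-> /F_faithful->].
Qed.

(** Reflection is an instance of [unique_lift]. For preservation, a test object [Y] of [D] is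
    replaced by an isomorphic [F X], where fullness and faithfulness apply. *)
Lemma pullback_fmap (A B Z P : C) (p1 : Hom P A) (p2 : Hom P B)
    (f : Hom A Z) (g : Hom B Z) :
  is_pullback (fmap F p1) (fmap F p2) (fmap F f) (fmap F g) <->
  is_pullback p1 p2 f g.
Proof.
rewrite /is_pullback -!fmap_comp; split=> -[sq pb].
  split=> [|X a b ab]; first exact: F_faithful.
  have /(pb (F X)) : fmap F f ∘ fmap F a = fmap F g ∘ fmap F b.
    by rewrite -!fmap_comp ab.
  apply: unique_lift => h.
  by rewrite -!fmap_comp; split=> -[] => [-> ->|/F_faithful-> /F_faithful->].
split=> [|Y a b ab]; first by rewrite sq.
have [X [x [x' [x'x xx']]]] := F_surj Y.
have [a' a'E] := F_full (a ∘ x); have [b' b'E] := F_full (b ∘ x).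
have /(pb X) [h [[h1 h2] h_uniq]] : f ∘ a' = g ∘ b'.
  by apply: F_faithful; rewrite !fmap_comp a'E b'E !comp_assoc ab.
exists (fmap F h ∘ x'); split.
  by rewrite !comp_assoc -!fmap_comp h1 h2 a'E b'E -!comp_assoc xx' !comp_idr.
move=> k [k1 k2]; have [k' k'E] := F_full (k ∘ x).
rewrite (h_uniq k') ?k'E; first by rewrite -comp_assoc xx' comp_idr.
by split; apply: F_faithful; rewrite fmap_comp k'E comp_assoc ?k1 ?k2 ?a'E ?b'E.
Qed.

Lemma fmap_mono (X Y : C) (m : Hom X Y) : is_mono m -> is_mono (fmap F m).
Proof.
move=> mono_m Z f g fg; have [W [w [w' [w'w ww']]]] := F_surj Z.
have [f' f'E] := F_full (f ∘ w); have [g' g'E] := F_full (g ∘ w).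
have fg' : f' = g'.
  by apply: mono_m; apply: F_faithful; rewrite !fmap_comp f'E g'E !comp_assoc fg.
by rewrite -(comp_idr f) -(comp_idr g) -ww' !comp_assoc -f'E -g'E fg'.
Qed.

Lemma transfer_limits : has_finite_limits D -> has_finite_limits C.
Proof.
move=> limD J finJ G.
pose FG := functor_comp F G.
have [c lim_c] := limD J finJ FG.
have [L [l [l' ll]]] := F_surj (apex c).
have [legs nat_legs univ] := limit_iso ll lim_c.
pose legC j : Hom L (G j) := projT1 (cid (F_full (legs j))).
have legCE j : fmap F (legC j) = legs j := projT2 (cid (F_full (legs j))).
have nat_legC i j (u : Hom i j) : fmap G u ∘ legC i = legC j.
  by apply: F_faithful; rewrite fmap_comp !legCE; apply: nat_legs.
exists {| apex := L; leg := legC; leg_natural := nat_legC |} => d.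
have nat_d i j (u : Hom i j) : fmap FG u ∘ fmap F (leg d i) = fmap F (leg d j).
  by rewrite -fmap_comp leg_natural.
pose Fd := @Build_Cone D J FG (F (apex d)) (fun j => fmap F (leg d j)) nat_d.
apply: unique_lift (univ Fd) => h /=.
split=> hE j; first by rewrite -legCE -fmap_comp hE.
by apply: F_faithful; rewrite fmap_comp legCE hE.
Qed.

(** The universal property is asserted in [D]: exponentials in [D] are tested against such images,
    and [reflect_product] yields the property in [C]. *)
Lemma transfer_product (A B : C) :
  (forall A B : D, exists (P : D) (p1 : Hom P A) (p2 : Hom P B), is_product p1 p2) ->
  exists (P : C) (p1 : Hom P A) (p2 : Hom P B), is_product (fmap F p1) (fmap F p2).
Proof.
move=> prodD; have [P [p1 [p2 prodP]]] := prodD (F A) (F B).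
have [Q [q [q' qq]]] := F_surj P.
have := product_iso (inverse_pair_id _) qq prodP.
have [r1 <-] := F_full (idm (F A) ∘ p1 ∘ q); have [r2 <-] := F_full (p2 ∘ q).
by exists Q, r1, r2.
Qed.

Lemma transfer_exponential (A B : C) :
  (forall A B : D, exists (P : D) (p1 : Hom P A) (p2 : Hom P B), is_product p1 p2) ->
  (exists (E EA : D) (p1 : Hom EA E) (p2 : Hom EA (F A)) (ev : Hom EA (F B)),
     is_exponential p1 p2 ev) ->
  exists (E EA : C) (p1 : Hom EA E) (p2 : Hom EA A) (ev : Hom EA B),
    is_exponential p1 p2 ev.
Proof.
move=> prodD [E [EA [p1 [p2 [ev expE]]]]].
have [E' [e [e' ee]]] := F_surj E; have [EA' [a [a' aa]]] := F_surj EA.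
have := exponential_iso ee aa expE.
have [r1 <-] := F_full (e' ∘ p1 ∘ a); have [r2 <-] := F_full (p2 ∘ a).
have [ev' <-] := F_full (ev ∘ a).
move=> [prodE univ]; exists E', EA', r1, r2, ev'.
apply: exponential_of_one_product; first exact: reflect_product.
move=> X; have [XA [q1 [q2 prodX]]] := transfer_product X A prodD.
exists XA, q1, q2; split=> [|f]; first exact: reflect_product.
apply: unique_lift (univ _ _ _ _ prodX (fmap F f)) => g.
split=> -[h [h1 h2 h3]].
  by exists (fmap F h); rewrite -!fmap_comp h1 h2 h3.
have [k kE] := F_full h; exists k.
by split; apply: F_faithful; rewrite !fmap_comp kE.
Qed.

Lemma transfer_closed : is_cartesian_closed D -> is_cartesian_closed C.
Proof.
move=> [[T termT] prodD expD]; split=> [|A B|A B].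
- have [T' [t [t' tt]]] := F_surj T.
  by exists T'; apply: reflect_terminal; apply: terminal_iso tt termT.
- have [P [p1 [p2 prodP]]] := transfer_product A B prodD.
  by exists P, p1, p2; apply: reflect_product.
- exact: transfer_exponential.
Qed.

Lemma transfer_classifier : has_subobject_classifier D -> has_subobject_classifier C.
Proof.
move=> [T [O [tr clT]]].
have [T' [t [t' tt]]] := F_surj T; have [O' [w [w' ww]]] := F_surj O.
have := classifier_iso tt ww clT; have [tr' <-] := F_full (w' ∘ tr ∘ t).
move=> [termT' univ]; exists T', O', tr'; split; first exact: reflect_terminal.
move=> U X m u /fmap_mono mono_m.
apply: unique_lift (univ _ _ _ (fmap F u) mono_m) => chi.
by rewrite pullback_fmap.
Qed.

Lemma transfer_topos : is_elementary_topos D -> is_elementary_topos C.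
Proof.
move=> [limD ccD clD]; split; first exact: transfer_limits.
- exact: transfer_closed.
- exact: transfer_classifier.
Qed.

End Transfer.

Definition inclusion (C : Category) (P : C -> Prop) : Functor (full_subcategory P) C :=
  {| fobj := fun X : full_subcategory P => sval X;
     fmap := fun X Y (f : @Hom (full_subcategory P) X Y) => f;
     fmap_id := fun X => erefl;
     fmap_comp := fun X Y Z g f => erefl |}.

(** The inclusion of a skeleton is an equivalence: it is the identity on morphisms, and each object
    is isomorphic to one in [S]. *)
Lemma skeleton_topos (C : Category) (S : C -> Prop) :
  is_skeleton S -> is_elementary_topos C -> is_elementary_topos (full_subcategory S).
Proof.
move=> [S_surj _]; apply: (@transfer_topos _ _ (inclusion S)) => //.
  by move=> X Y h; exists h.
move=> Y; have [X SX [f [g [gf fg]]]] := S_surj Y.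
by exists (exist _ X SX), g, f.
Qed.

(** * Maps of finite sets *)

Lemma unique_sval (T : Type) (P : T -> Prop) (exP : exists! x, P x) :
  {x | P x & forall y, P y -> y = x}.
Proof.
have [x Px] := cid exP; exists x; first by case: Px.
by move=> y Py; case: Px => _ /(_ y Py).
Qed.

(** The limit is the set of compatible families. Indexing them by the ordinal that enumerates [J],
    and making compatibility boolean classically, turns them into a [finType]. *)
Lemma finite_diagram_limit (J : Category) (A : J -> finType)
    (a : forall i j : J, Hom i j -> A i -> A j) :
  is_finite J ->
  (forall (i j k : J) (v : Hom j k) (u : Hom i j) x,
    a _ _ (v ∘ u) x = a _ _ v (a _ _ u x)) ->
  exists (L : finType) (l : forall j, L -> A j),
    (forall (i j : J) (u : Hom i j) y, a _ _ u (l i y) = l j y) /\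
    forall x : (forall j, A j), (forall (i j : J) (u : Hom i j), a _ _ u (x i) = x j) ->
    exists! y, forall j, l j y = x j.
Proof.
move=> [n [e e_surj]] a_comp.
pose compatible (y : {dffun forall k : 'I_n, A (e k)}) :=
  `[< forall (k m : 'I_n) (u : Hom (e k) (e m)), a _ _ u (y k) = y m >].
pose L : finType := {y | compatible y}.
have LP (y : L) k m (u : Hom (e k) (e m)) : a _ _ u (val y k) = val y m.
  by have /asboolP := valP y; apply.
(* Since [e] only hits [j] up to propositional equality, the [j]-th projection is
   the coordinate at some [k] transported along an isomorphism [e k -> j]. *)
have ind j : {k : 'I_n & {f : Hom (e k) j & {g : Hom j (e k) | f ∘ g = idm j}}}.
  have [k <-] := cid (e_surj j); exists k, (idm _), (idm _); exact: comp_idl.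
pose from j := projT1 (projT2 (ind j)).
pose to j := sval (projT2 (projT2 (ind j))).
have from_to j : from j ∘ to j = idm j := svalP (projT2 (projT2 (ind j))).
exists L, (fun j (y : L) => a _ _ (from j) (val y (projT1 (ind j)))); split.
  move=> i j u y.
  (* Conjugating [u] gives an arrow between enumerated objects, to which compatibility applies; then
     [from j ∘ to j] cancels. *)
  rewrite -(LP y _ _ (to j ∘ u ∘ from i)) -!a_comp -(comp_assoc (to j)).
  by rewrite compK.
move=> x xP; have xL : compatible [ffun k => x (e k)].
  by apply/asboolP => k m u; rewrite !ffunE.
exists (exist (fun y => compatible y) _ xL : L); split=> [j|y yE]; first by rewrite ffunE.
by apply/val_inj/ffunP => k; rewrite ffunE -yE LP.
Qed.

(** * The category of maps of finite sets and its finite limits *)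

Record bundle := Bundle { base : finType; total : finType; proj : total -> base }.

Record bundle_hom (A B : bundle) := BundleHom {
  on_base : base A -> base B;
  on_total : total A -> total B;
  on_proj : forall x, proj (on_total x) = on_base (proj x) }.

Lemma bundle_hom_ext (A B : bundle) (f g : bundle_hom A B) :
  on_base f =1 on_base g -> on_total f =1 on_total g -> f = g.
Proof.
case: f g => [f0 f1 fP] [g0 g1 gP] /= /funext f0g /funext f1g.
by subst g0 g1; congr BundleHom; apply: Prop_irrelevance.
Qed.

Definition bundle_id (A : bundle) : bundle_hom A A :=
  @BundleHom A A id id (fun x => erefl).

Definition bundle_comp (A B C : bundle) (g : bundle_hom B C) (f : bundle_hom A B) :
    bundle_hom A C :=
  @BundleHom A C (on_base g \o on_base f) (on_total g \o on_total f)
    (fun x => etrans (on_proj g (on_total f x)) (congr1 (on_base g) (on_proj f x))).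

Program Definition Bun : Category := {|
  Obj := bundle;
  Hom := bundle_hom;
  idm := bundle_id;
  comp := bundle_comp |}.
Solve All Obligations with by move=> *; apply: bundle_hom_ext.

Lemma bundle_homP (A B : bundle) (f g : bundle_hom A B) :
  f = g <-> on_base f =1 on_base g /\ on_total f =1 on_total g.
Proof. by split=> [->//|[]]; apply: bundle_hom_ext. Qed.

(** Limits are pointwise: [L0] and [L1] are the limits of the bases and of the total spaces, and the
    universal property of [L0] induces the projection [p] between them. Uniqueness for [L0] also
    makes the mediating maps commute with the projections. *)
Lemma bundle_limits : has_finite_limits Bun.
Proof.
move=> J [finJ _] F.
have [|L0 [l0 [l0P l0_univ]]] :=
  @finite_diagram_limit J (fun j => base (F j)) (fun i j u => on_base (fmap F u)) finJ.
  by move=> i j k v u x; rewrite fmap_comp.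
have [|L1 [l1 [l1P l1_univ]]] :=
  @finite_diagram_limit J (fun j => total (F j)) (fun i j u => on_total (fmap F u)) finJ.
  by move=> i j k v u x; rewrite fmap_comp.
have p_ex y : exists! z : L0, forall j, l0 j z = proj (l1 j y).
  by apply: l0_univ => i j u; rewrite -on_proj l1P.
pose p y := s2val (unique_sval (p_ex y)).
have pP y j : l0 j (p y) = proj (l1 j y) := s2valP (unique_sval (p_ex y)) j.
pose leg j := @BundleHom (Bundle p) (F j) (l0 j) (l1 j) (fun y => esym (pP y j)).
have leg_nat i j (u : Hom i j) : fmap F u ∘ (leg i : @Hom Bun _ _) = leg j.
  by apply: bundle_hom_ext => y /=; rewrite ?l0P ?l1P.
exists (@Build_Cone Bun J F (Bundle p) leg leg_nat) => d.
have h0_ex x : exists! z : L0, forall j, l0 j z = on_base (Defs.leg d j) x.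
  by apply: l0_univ => i j u; rewrite -(leg_natural d u).
have h1_ex x : exists! z : L1, forall j, l1 j z = on_total (Defs.leg d j) x.
  by apply: l1_univ => i j u; rewrite -(leg_natural d u).
pose h0 x := s2val (unique_sval (h0_ex x)).
pose h1 x := s2val (unique_sval (h1_ex x)).
have h0P x j : l0 j (h0 x) = on_base (Defs.leg d j) x := s2valP (unique_sval (h0_ex x)) j.
have h1P x j : l1 j (h1 x) = on_total (Defs.leg d j) x := s2valP (unique_sval (h1_ex x)) j.
have hP x : p (h1 x) = h0 (proj x).
  apply: (s2valP' (unique_sval (h0_ex (proj x)))) => j.
  by rewrite pP h1P on_proj.
exists (@BundleHom (apex d) (Bundle p) h0 h1 hP); split.
  by move=> j; apply: bundle_hom_ext => x /=; rewrite ?h0P ?h1P.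
move=> k kE; apply: bundle_hom_ext => x /=; apply: esym.
  by apply: (s2valP' (unique_sval (h0_ex x))) => j; rewrite -kE.
by apply: (s2valP' (unique_sval (h1_ex x))) => j; rewrite -kE.
Qed.

(** * Cartesian closure of the category of maps *)

Definition point : bundle := @Bundle unit unit id.

Lemma point_terminal : @is_terminal Bun point.
Proof.
move=> X; exists (@BundleHom X point (fun=> tt) (fun=> tt) (fun=> erefl)).
split=> // f _; apply: bundle_hom_ext => x /=; first by case: (on_base f x).
by case: (on_total f x).
Qed.

Definition bundle_prod (A B : bundle) : bundle :=
  @Bundle (base A * base B)%type (total A * total B)%type
    (fun x => (proj x.1, proj x.2)).

Definition bundle_fst (A B : bundle) : @Hom Bun (bundle_prod A B) A :=
  @BundleHom (bundle_prod A B) A fst fst (fun=> erefl).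

Definition bundle_snd (A B : bundle) : @Hom Bun (bundle_prod A B) B :=
  @BundleHom (bundle_prod A B) B snd snd (fun=> erefl).

Lemma bundle_prodP (A B : bundle) :
  @is_product Bun A B (bundle_prod A B) (bundle_fst A B) (bundle_snd A B).
Proof.
move=> X f g.
have hP x : proj (b := bundle_prod A B) (on_total f x, on_total g x) =
    (on_base f (proj x), on_base g (proj x)) by rewrite /= !on_proj.
exists (@BundleHom X (bundle_prod A B) (fun x => (on_base f x, on_base g x))
   (fun x => (on_total f x, on_total g x)) hP).
split; first by split; apply: bundle_hom_ext.
move=> h [hf hg]; apply: bundle_hom_ext => x /=; rewrite -hf -hg /=;
  by rewrite -surjective_pairing.
Qed.

(** Boolean, so that the pairs satisfying it form a [finType]. *)
Definition is_bundle_map (A B : bundle)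
    (f : {ffun base A -> base B} * {ffun total A -> total B}) :=
  [forall x, proj (f.2 x) == f.1 (proj x)].

(* [base] and [total] are represented by the bundles [0 -> 1] and [1 -> 1], so by
   Yoneda the exponential has as base the maps between the bases ([(0 -> 1) x A] has
   empty total space) and as total space the bundle maps. *)
Definition bundle_exp (A B : bundle) : bundle :=
  @Bundle {ffun base A -> base B} {f | @is_bundle_map A B f}
    (fun f => (val f).1).

Definition bundle_ev (A B : bundle) : @Hom Bun (bundle_prod (bundle_exp A B) A) B :=
  @BundleHom (bundle_prod (bundle_exp A B) A) B
    (fun x => x.1 x.2) (fun x => (val x.1).2 x.2)
    (fun x => eqP (forallP (valP x.1) x.2)).

Lemma bundle_expP (A B : bundle) :
  @is_exponential Bun A B (bundle_exp A B) (bundle_prod (bundle_exp A B) A)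
    (bundle_fst _ _) (bundle_snd _ _) (bundle_ev A B).
Proof.
apply: exponential_of_one_product; first exact: bundle_prodP.
move=> X; exists (bundle_prod X A), (bundle_fst X A), (bundle_snd X A).
split=> [|f]; first exact: bundle_prodP.
pose g0 (x : base X) := [ffun a : base A => on_base f (x, a)].
pose g1 (x : total X) : {ffun base A -> base B} * {ffun total A -> total B} :=
  (g0 (proj x), [ffun a : total A => on_total f (x, a)]).
have g1P x : is_bundle_map (g1 x).
  by apply/forallP => a; rewrite /= !ffunE; apply/eqP; exact: (on_proj f (x, a)).
pose g := @BundleHom X (bundle_exp A B) g0 (fun x => exist _ (g1 x) (g1P x)) (fun=> erefl).
pose h := @BundleHom (bundle_prod X A) (bundle_prod (bundle_exp A B) A)
  (fun x => (on_base g x.1, x.2)) (fun x => (on_total g x.1, x.2)) (fun=> erefl).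
exists g; split.
  exists h; split; [exact: bundle_hom_ext|exact: bundle_hom_ext|].
  by apply: bundle_hom_ext => -[x a] /=; rewrite ffunE.
move=> k [l [/bundle_homP[l10 l11] /bundle_homP[l20 l21] /bundle_homP[l30 l31]]].
have kE0 x : g0 x = on_base k x.
  apply/ffunP => a; rewrite ffunE -(l30 (x, a)) /=.
  by have /= -> := l10 (x, a); have /= -> := l20 (x, a).
apply: bundle_hom_ext => x //=; apply: val_inj => /=.
(* The base component of [on_total k x] is forced by compatibility with the projections, leaving
   only its action on total spaces to compare. *)
rewrite /g1 kE0 [RHS]surjective_pairing; congr pair; first exact: esym (on_proj k x).
apply/ffunP => a; rewrite ffunE -(l31 (x, a)) /=.
by have /= -> := l11 (x, a); have /= -> := l21 (x, a).
Qed.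

Lemma bundle_closed : is_cartesian_closed Bun.
Proof.
split=> [|A B|A B].
- by exists point; exact: point_terminal.
- by exists (bundle_prod A B), (bundle_fst A B), (bundle_snd A B); exact: bundle_prodP.
- exists (bundle_exp A B), (bundle_prod (bundle_exp A B) A), (bundle_fst _ _).
  by exists (bundle_snd _ _), (bundle_ev A B); exact: bundle_expP.
Qed.

(* Mono can be tested on these, as [0 -> 1] and [1 -> 1] represent [base] and [total]. *)
Definition base_elt (A : bundle) (x : base A) :
    @Hom Bun (@Bundle unit void (of_void unit)) A :=
  @BundleHom (@Bundle unit void (of_void unit)) A (fun=> x) (of_void (total A))
    (fun v => match v with end).

Definition total_elt (A : bundle) (x : total A) : @Hom Bun point A :=
  @BundleHom point A (fun=> proj x) (fun=> x) (fun=> erefl).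

Lemma bundle_mono_inj (U X : bundle) (m : @Hom Bun U X) :
  is_mono m -> injective (on_base m) /\ injective (on_total m).
Proof.
move=> mono_m; split=> x y xy.
  suff /bundle_homP[/(_ tt)] : base_elt x = base_elt y by [].
  by apply: mono_m; apply: bundle_hom_ext => //= ?; rewrite xy.
suff /bundle_homP[_ /(_ tt)] : total_elt x = total_elt y by [].
by apply: mono_m; apply: bundle_hom_ext => _ //=; rewrite -2!on_proj xy.
Qed.

(* A point of the total space of the classifier records whether an element of the
   total space, respectively its projection, belongs to the subobject. *)
Definition bundle_omega : bundle :=
  @Bundle bool {b : bool * bool | b.1 ==> b.2} (fun b => (val b).2).

Definition bundle_true : @Hom Bun point bundle_omega :=
  @BundleHom point bundle_omega (fun=> true)
    (fun=> exist _ (true, true) isT) (fun=> erefl).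

Lemma bundle_classifier : has_subobject_classifier Bun.
Proof.
exists point, bundle_omega, bundle_true; split; first exact: point_terminal.
move=> U X m u mono_m; have [m0_inj m1_inj] := bundle_mono_inj mono_m.
pose c0 x := x \in codom (on_base m).
pose c1 x := (x \in codom (on_total m), c0 (proj x)).
have c1P x : (c1 x).1 ==> (c1 x).2.
  by apply/implyP => /codomP[y ->]; rewrite /= on_proj /c0 codom_f.
pose chi := @BundleHom X bundle_omega c0 (fun x => exist _ (c1 x) (c1P x)) (fun=> erefl).
exists chi; split.
  split.
    apply: bundle_hom_ext => x /=; first by rewrite /c0 codom_f.
    by apply: val_inj; rewrite /= /c1 on_proj /c0 !codom_f.
  move=> Z a b /bundle_homP[/= ab0 /= ab1].
  have a0 z : exists y, on_base m y = on_base a z.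
    by have /codomP[y ->] := ab0 z; exists y.
  have a1 z : exists y, on_total m y = on_total a z.
    by have [/codomP[y ->] _] := congr1 val (ab1 z); exists y.
  (* Preimages are chosen independently on base and total space; injectivity of [m] on bases makes
     the two choices compatible. *)
  have [h0 h0P] := choice a0; have [h1 h1P] := choice a1.
  have hP z : proj (h1 z) = h0 (proj z).
    by apply: m0_inj; rewrite -on_proj h1P h0P on_proj.
  exists (@BundleHom Z U h0 h1 hP); split.
    split; first exact: bundle_hom_ext.
    by apply: bundle_hom_ext => z /=; [case: (on_base _ _) (on_base b z) => -[]
      | case: (on_total _ _) (on_total b z) => -[]].
  by move=> k [ka _]; apply: mono_m; rewrite [RHS]ka; apply: bundle_hom_ext.
(* Uniqueness: an element that [chi2] sends to the true point gives a commuting square on [base_elt]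
   or [total_elt], and its factorisation through [U] exhibits a preimage under [m]. *)
move=> chi2 [/bundle_homP[sq0 sq1] pb].
have u0 x : on_base chi2 x = c0 x.
  apply/idP/codomP => [x_in|[y ->]]; last exact: sq0.
  have [|h [[/bundle_homP[mh0 _] _] _]] := pb _ (base_elt x) (@base_elt point tt).
    by apply: bundle_hom_ext.
  by exists (on_base h tt); exact: esym (mh0 tt).
have u1 x : (val (on_total chi2 x)).1 = (x \in codom (on_total m)).
  apply/idP/codomP => [x_in|[y ->]]; last by rewrite [on_total _ _]sq1.
  have [|h [[/bundle_homP[_ mh1] _] _]] := pb _ (total_elt x) (@total_elt point tt).
    (* Once the first bit is true, the implication defining [bundle_omega] makes the second true, so
       [x] goes to the true point on both levels. *)
    apply: bundle_hom_ext => _ /=.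
      by rewrite -on_proj; have /implyP := valP (on_total chi2 x); apply.
    apply: val_inj; rewrite [LHS]surjective_pairing; congr pair => //.
    by have /implyP := valP (on_total chi2 x); apply.
  by exists (on_total h tt); exact: esym (mh1 tt).
apply: bundle_hom_ext => x /=; first by rewrite u0.
apply: val_inj; rewrite /= [RHS]surjective_pairing u1; congr pair.
(* The second bit is the projection, hence determined by [chi2] on the base. *)
by rewrite -u0 -on_proj.
Qed.

Lemma bundle_topos : is_elementary_topos Bun.
Proof.
by split; [exact: bundle_limits|exact: bundle_closed|exact: bundle_classifier].
Qed.

(** * Dirichlet functors as maps of finite sets *)

Definition from_void (X : finType) : {ffun void -> X} := [ffun v => of_void X v].

Definition pick_point (X : finType) (x : X) : {ffun unit -> X} := [ffun=> x].

Definition at_base (G : Presheaf) (X : finType) (s : G X) : G void :=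
  fmap G (X := X) (Y := void) (from_void X) s.

Definition at_point (G : Presheaf) (X : finType) (x : X) (s : G X) : G unit :=
  fmap G (X := X) (Y := unit) (pick_point x) s.

(** This makes G(X) the X-fold fibre power of G(1) over G(0). The base [g] is a separate datum
    because an empty [X] leaves no point from which to read it. *)
Definition glues (G : Presheaf) := forall (X : finType) (g : G void) (s : X -> G unit),
  (forall x, at_base (s x) = g) ->
  exists! t : G X, at_base t = g /\ forall x, at_point x t = s x.

Lemma fin_compE (X Y Z : Fin) (g : Hom Y Z) (f : Hom X Y) (x : X) :
  (g ∘ f) x = g (f x).
Proof. exact: ffunE. Qed.

Lemma fmap_compE (G : Presheaf) (X Y Z : finType) (f : {ffun Y -> X})
    (g : {ffun Z -> Y}) (h : {ffun Z -> X}) (s : G X) :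
  fin_comp f g = h ->
  fmap G (X := Y) (Y := Z) g (fmap G (X := X) (Y := Y) f s) =
  fmap G (X := X) (Y := Z) h s.
Proof.
by move=> <-; rewrite (@fmap_comp _ _ G X Y Z g f) ffunE.
Qed.

Lemma at_base_point (G : Presheaf) (X : finType) (x : X) (s : G X) :
  at_base (at_point x s) = at_base s.
Proof. by apply: fmap_compE; apply/ffunP => -[]. Qed.

Lemma nat_fmap (D G : Presheaf) (t : NatTrans D G) (X Y : finType)
    (f : {ffun Y -> X}) (s : D X) :
  t Y (fmap D (X := X) (Y := Y) f s) = fmap G (X := X) (Y := Y) f (t X s).
Proof. by have /ffunP/(_ s) := naturality t (X := X) (Y := Y) f; rewrite !ffunE. Qed.

Lemma nat_at_base (D G : Presheaf) (t : NatTrans D G) (X : finType) (s : D X) :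
  t void (at_base s) = at_base (t X s).
Proof. exact: nat_fmap. Qed.

Lemma nat_at_point (D G : Presheaf) (t : NatTrans D G) (X : finType) (x : X) (s : D X) :
  t unit (at_point x s) = at_point x (t X s).
Proof. exact: nat_fmap. Qed.

Lemma glues_iso (D G : Presheaf) : isomorphic D G -> glues G -> glues D.
Proof.
move=> [t [r [rt tr]]] glG X g s sg.
have rtK Y : cancel (t Y) (r Y).
  move=> y; have /(congr1 (fun n : NatTrans D D => n Y y)) := rt.
  by rewrite /= !ffunE.
have trK Y : cancel (r Y) (t Y).
  move=> y; have /(congr1 (fun n : NatTrans G G => n Y y)) := tr.
  by rewrite /= !ffunE.
have [|u [[u0 u1] u_uniq]] := glG X (t void g) (fun x => t unit (s x)).
  by move=> x; rewrite -nat_at_base sg.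
exists (r X u); split.
  split=> [|x]; first by rewrite -nat_at_base u0 rtK.
  by rewrite -nat_at_point u1 rtK.
move=> v [v0 v1]; rewrite (u_uniq (t X v)) ?rtK //; split=> [|x].
  by rewrite -nat_at_base v0.
by rewrite -nat_at_point v1.
Qed.

Definition dirichlet_sum (I : finType) (d : I -> finType) : Presheaf :=
  presheaf_sum (fun i => representable (d i)).

Lemma dirichlet_sum_fmap (I : finType) (d : I -> finType) (X Y : finType)
    (f : {ffun Y -> X}) (i : I) (s : {ffun X -> d i}) :
  fmap (dirichlet_sum d) (X := X) (Y := Y) f
    (existT (fun i => {ffun X -> d i} : finType) i s) =
  existT (fun i => {ffun Y -> d i} : finType) i [ffun y => s (f y)].
Proof. by rewrite /= ffunE /= ffunE. Qed.

Lemma existT_injr (I : Type) (P : I -> Type) (i : I) (a b : P i) :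
  existT P i a = existT P i b -> a = b.
Proof.
move=> ab; have := @projT2_eq _ _ _ _ ab.
by rewrite (Prop_irrelevance (projT1_eq ab) erefl).
Qed.

(** An element over [X] is an index [i] with a function from [X] to [d i]: its base records the
    index and its points record the values. A common base forces all the [s x] into one summand,
    where their values assemble into a function. *)
Lemma dirichlet_sum_glues (I : finType) (d : I -> finType) : glues (dirichlet_sum d).
Proof.
move=> X [i g] s sg.
have sE x : exists a : d i,
      s x = existT (fun i => {ffun unit -> d i} : finType) i [ffun=> a].
  have := sg x; case: (s x) => j a /=.
  rewrite /at_base dirichlet_sum_fmap => /(congr1 (@projT1 _ _)) /= ji; subst j.
  by exists (a tt); congr existT; apply/ffunP => -[]; rewrite ffunE.
have [a aE] := choice sE.
exists (existT (fun i => {ffun X -> d i} : finType) i [ffun x => a x]); split.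
  split=> [|x].
    rewrite /at_base dirichlet_sum_fmap; congr existT.
    by apply/ffunP => -[].
  rewrite /at_point dirichlet_sum_fmap aE; congr existT.
  by apply/ffunP => u; rewrite !ffunE.
move=> [j b]; rewrite /at_base /at_point dirichlet_sum_fmap => -[].
move=> /(congr1 (@projT1 _ _)) /= ji; subst j => bE; congr existT.
apply/ffunP => x; have := bE x.
rewrite dirichlet_sum_fmap aE => h.
have := congr1 (fun f : {ffun unit -> d i} => f tt) (existT_injr h).
by rewrite !ffunE.
Qed.

Lemma dirichlet_glues (G : Presheaf) : is_dirichlet G -> glues G.
Proof. by move=> [d /glues_iso]; apply; exact: dirichlet_sum_glues. Qed.

Lemma bijective_nat_iso (D G : Presheaf) (t : NatTrans D G) :
  (forall X, injective (t X)) -> (forall X y, exists x, t X x = y) ->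
  isomorphic D G.
Proof.
move=> t_inj t_surj; pose r X : {ffun G X -> D X} := [ffun y => sval (cid (t_surj X y))].
have rt X : cancel (r X) (t X) by move=> y; rewrite ffunE; case: cid.
have tr X : cancel (t X) (r X) by move=> x; apply: t_inj; rewrite rt.
have r_nat (X Y : opposite Fin) (f : Hom X Y) :
    @comp Fin _ _ _ (r Y) (fmap G f) = @comp Fin _ _ _ (fmap D f) (r X).
  apply/ffunP => y; rewrite !fin_compE.
  by apply: t_inj; rewrite rt nat_fmap rt.
exists t, (@Build_NatTrans (opposite Fin) Fin G D r r_nat).
split; apply: NatTrans_ext => X; apply/ffunP => x; rewrite [RHS]ffunE.
  exact: etrans (fin_compE _ _ _) (tr X x).
exact: etrans (fin_compE _ _ _) (rt X x).
Qed.

(** The sum is reindexed from [I] to the ordinal that [is_dirichlet] prescribes, along the bijection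
    [h] reading off the summand of the k-th element over [void]. *)
Lemma is_dirichlet_sum (I : finType) (d : I -> finType) : is_dirichlet (dirichlet_sum d).
Proof.
pose S := dirichlet_sum d; pose h (k : 'I_#|S void|) : I := tag (enum_val k).
exists (fun k => d (h k)).
have h_inj : injective h.
  move=> k l kl; apply: enum_val_inj; move: kl; rewrite /h.
  case: (enum_val k) (enum_val l) => [i a] [j b] /= ij; subst j.
  by congr existT; apply/ffunP => -[].
have h_surj i : exists k, h k = i.
  pose z : S void := existT (fun i => {ffun void -> d i} : finType) i (from_void (d i)).
  by exists (enum_rank z); rewrite /h enum_rankK.
pose t (X : finType) : {ffun dirichlet_sum (fun k => d (h k)) X -> S X} :=
  [ffun s => existT (fun i => {ffun X -> d i} : finType) (h (tag s)) (tagged s)].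
have t_nat (X Y : opposite Fin) (f : Hom X Y) :
    @comp Fin _ _ _ (t Y) (fmap (dirichlet_sum (fun k => d (h k))) f) =
    @comp Fin _ _ _ (fmap S f) (t X).
  by apply/ffunP => -[k s]; rewrite /= !ffunE.
have tE (X : opposite Fin) s : t X s =
    existT (fun i => {ffun X -> d i} : finType) (h (tag s)) (tagged s) by rewrite ffunE.
have [f [g [gf fg]]] : isomorphic (dirichlet_sum (fun k => d (h k))) S.
  apply: (@bijective_nat_iso _ _ (@Build_NatTrans (opposite Fin) Fin _ _ t t_nat)) => X /=.
    move=> [k a] [l b]; rewrite !tE /= => ab.
    have kl : k = l by apply: h_inj; apply: (congr1 (@projT1 _ _) ab).
    by subst l; rewrite (existT_injr ab).
  move=> [i a]; have [k ki] := h_surj i; subst i.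
  by exists (existT (fun k => {ffun X -> d (h k)} : finType) k a); rewrite tE.
by exists g, f.
Qed.

(** * The equivalence between Dirichlet functors and maps of finite sets *)

Lemma bundle_isomorphic (A B : bundle) (f : @Hom Bun A B) :
  injective (on_base f) -> (forall y, exists x, on_base f x = y) ->
  injective (on_total f) -> (forall y, exists x, on_total f x = y) ->
  @isomorphic Bun A B.
Proof.
move=> f0_inj /choice[g0 g0K] f1_inj /choice[g1 g1K].
have gP y : proj (g1 y) = g0 (proj y).
  by apply: f0_inj; rewrite -on_proj g1K g0K.
exists f, (@BundleHom B A g0 g1 gP).
split; apply: bundle_hom_ext => x //=; [apply: f0_inj|apply: f1_inj].
  by rewrite g0K.
by rewrite g1K.
Qed.

Lemma at_base_void (G : Presheaf) (s : G void) : at_base s = s.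
Proof.
have -> : at_base s = fmap G (idm (void : opposite Fin)) s.
  by rewrite /at_base; congr (fmap G _ s); apply/ffunP => -[].
by rewrite fmap_id ffunE.
Qed.

Definition dirichlet_bundle (D : Presheaf) : bundle :=
  @Bundle (D void) (D unit) (@at_base D unit).

Definition dirichlet_bundle_map (D G : Presheaf) (t : NatTrans D G) :
    bundle_hom (dirichlet_bundle D) (dirichlet_bundle G) :=
  @BundleHom (dirichlet_bundle D) (dirichlet_bundle G) (t void) (t unit)
    (fun x => esym (nat_fmap t (from_void unit) x)).

Program Definition bundle_functor : Functor Dir Bun := {|
  fobj := fun D : Dir => dirichlet_bundle (sval D);
  fmap := fun X Y t => dirichlet_bundle_map t |}.
Next Obligation. by apply: bundle_hom_ext => x /=; rewrite ffunE. Qed.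
Next Obligation. by apply: bundle_hom_ext => x /=; rewrite ffunE. Qed.

(** By naturality, [s X x] and [t X x] have the same base and the same points, so uniqueness of
    gluing identifies them. *)
Lemma bundle_functor_faithful (D G : Dir) (s t : Hom D G) :
  fmap bundle_functor s = fmap bundle_functor t -> s = t.
Proof.
move=> /bundle_homP[/= st0 st1]; apply: NatTrans_ext => X; apply/ffunP => x.
have [|u [_ u_uniq]] :=
  @dirichlet_glues _ (svalP G) X (s void (at_base x)) (fun a => s unit (at_point a x)).
  by move=> a; rewrite -nat_at_base at_base_point.
rewrite -(u_uniq (s X x)); last by split=> [|a]; rewrite ?nat_at_base ?nat_at_point.
apply: u_uniq.
by split=> [|a]; rewrite -?nat_at_base -?nat_at_point ?st0 ?st1.
Qed.

(** The transformation sends [x] to the unique gluing in [G] of the images under [h] of the base and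
    the points of [x]. *)
Lemma bundle_functor_full (D G : Dir)
    (h : Hom (bundle_functor D) (bundle_functor G)) :
  exists t : Hom D G, fmap bundle_functor t = h.
Proof.
have univ (X : finType) (x : sval D X) : exists! u : sval G X,
    at_base u = on_base h (at_base x) /\
    forall a, at_point a u = on_total h (at_point a x).
  apply: dirichlet_glues; first exact: svalP.
  by move=> a; rewrite [LHS](on_proj h) [proj _]at_base_point.
pose t (X : finType) : {ffun sval D X -> sval G X} :=
  [ffun x => s2val (unique_sval (univ X x))].
have t0 X x : at_base (t X x) = on_base h (at_base x).
  by rewrite ffunE; case: unique_sval => u [].
have t1 X x a : at_point a (t X x) = on_total h (at_point a x).
  by rewrite ffunE; case: unique_sval => u [].
have tP X x u : at_base u = on_base h (at_base x) ->
    (forall a, at_point a u = on_total h (at_point a x)) -> u = t X x.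
  by move=> u0 u1; rewrite ffunE; apply: (s2valP' (unique_sval (univ X x))).
have t_nat (X Y : opposite Fin) (f : Hom X Y) :
    @comp Fin _ _ _ (t Y) (fmap (sval D) f) = @comp Fin _ _ _ (fmap (sval G) f) (t X).
  (* Naturality follows from uniqueness of gluing: restriction along [f] keeps the base, and its
     point at [a] is the original point at [f a]. *)
  apply/ffunP => x; rewrite !fin_compE; apply: esym; apply: tP => [|a].
    rewrite /at_base !(@fmap_compE _ _ _ _ _ _ (from_void X)); first exact: t0.
      by apply/ffunP => -[].
    by apply/ffunP => -[].
  rewrite /at_point !(@fmap_compE _ _ _ _ _ _ (pick_point ((f : {ffun Y -> X}) a))).
      exact: t1.
    by apply/ffunP => u; rewrite !ffunE.
  by apply/ffunP => u; rewrite !ffunE.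
exists (@Build_NatTrans (opposite Fin) Fin (sval D) (sval G) t t_nat).
apply: bundle_hom_ext => x /=.
  by rewrite -[LHS]at_base_void t0 at_base_void.
have at_tt (E : Presheaf) (y : E unit) : at_point tt y = y.
  have -> : at_point tt y = fmap E (idm (unit : opposite Fin)) y.
    by rewrite /at_point; congr (fmap E _ y); apply/ffunP => -[]; rewrite !ffunE.
  by rewrite fmap_id ffunE.
by rewrite -[LHS]at_tt t1 at_tt.
Qed.

(** The preimage is the sum, over the base of [B], of the presheaves represented by the fibres. *)
Lemma bundle_functor_surj (B : Bun) :
  exists D : Dir, isomorphic (bundle_functor D) B.
Proof.
pose d (i : base B) : finType := {x : total B | proj x == i}.
exists (exist _ (dirichlet_sum d) (is_dirichlet_sum d)).
pose f0 (s : dirichlet_sum d void) : base B := tag s.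
pose f1 (s : dirichlet_sum d unit) : total B := val (tagged s tt).
have fP s : proj (f1 s) = f0 (at_base s).
  by case: s => i a; rewrite /at_base dirichlet_sum_fmap; apply/eqP/(valP (a tt)).
pose f : @Hom Bun (dirichlet_bundle (dirichlet_sum d)) B :=
  @BundleHom (dirichlet_bundle (dirichlet_sum d)) B f0 f1 fP.
apply: (bundle_isomorphic (f := f)) => /=.
- move=> [i a] [j b]; rewrite /f0 /= => ij; subst j.
  by congr existT; apply/ffunP => -[].
- by move=> i; exists (existT (fun i => {ffun void -> d i} : finType) i (from_void (d i))).
(* The summand of an element over [unit] is recovered by projecting its value, which lies in the
   corresponding fibre. *)
- move=> s r sr; have : tag s = tag r.
    rewrite -[tag s](eqP (valP (tagged s tt))).
    by rewrite -[tag r](eqP (valP (tagged r tt))) [val _]sr.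
  case: s r sr => [i a] [j b]; rewrite /f1 /= => ab ij; subst j.
  by congr existT; apply/ffunP => -[]; apply: val_inj.
- move=> x.
  pose y : d (proj x) := exist _ x (eqxx (proj x)).
  exists (existT (fun i => {ffun unit -> d i} : finType) (proj x) [ffun=> y]).
  by rewrite /f1 /= ffunE.
Qed.

Theorem corollary4p7 :
  is_elementary_topos Dir /\
  (forall S : Dir -> Prop, is_skeleton S ->
    is_elementary_topos (full_subcategory S)).
Proof.
have topos_Dir : is_elementary_topos Dir.
  apply: (transfer_topos (F := bundle_functor)).
  - exact: bundle_functor_full.
  - exact: bundle_functor_faithful.
  - exact: bundle_functor_surj.
  - exact: bundle_topos.
by split=> // S skS; apply: skeleton_topos.
Qed.
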